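(* Let $\lambda>0$, let $\kappa$ be a nonnegative integer, and let $\beta>-1$. Then, for every integer $k\ge 0$, $$P_k^{(1,\beta)}(t)=q_k^{(\beta)}(t)+\sum_{j=\max(0,\,k-(\kappa+1))}^{k-1}a_{k,j}^{(\beta)}\,q_j^{(\beta)}(t),\qquad\text{where}\quad a_{k,j}^{(\beta)}=\frac{(P_k^{(1,\beta)},q_j^{(\beta)})_\beta}{(q_j^{(\beta)},q_j^{(\beta)})_\beta}.$$
   Context: $P_k^{(\alpha,\beta)}$ denotes the classical Jacobi polynomial of degree $k$, orthogonal on $[-1,1]$ with respect to the weight $(1-t)^\alpha(1+t)^\beta$ (for $\alpha,\beta>-1$) and normalized by $P_k^{(\alpha,\beta)}(1)=\binom{k+\alpha}{k}=\frac{(\alpha+1)_k}{k!}$. The univariate Sobolev inner product on real polynomials is $$(f,g)_\beta=\frac{\lambda}{2^{\kappa+3}}\int_{-1}^1 f(t)g(t)(1-t)^{\kappa+2}(1+t)^{\beta}\,dt+\int_{-1}^1\frac{d}{dt}\big((1-t)f(t)\big)\,\frac{d}{dt}\big((1-t)g(t)\big)\,(1+t)^{\beta+1}\,dt .$$ $\{q_k^{(\beta)}\}_{k\ge 0}$ is the sequence of polynomials orthogonal with respect to $(\cdot,\cdot)_\beta$, with $q_k^{(\beta)}$ of degree $k$, normalized so that it has the same leading coefficient as $P_k^{(1,\beta)}$, namely $k_k^{(1,\beta)}=\frac{1}{2^k}\binom{2k+\beta+1}{k}$. *)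

(* Defs.v *)
From HB Require Import structures.
From mathcomp Require Import all_boot all_order all_algebra.
From mathcomp Require Import all_classical all_reals all_analysis.

Set Implicit Arguments.
Unset Strict Implicit.
Unset Printing Implicit Defensive.

Import Order.TTheory GRing.Theory Num.Theory.
Local Open Scope classical_set_scope.
Local Open Scope ring_scope.

(* Rising factorial (a)_k = a (a + 1) ... (a + k - 1). *)
Definition pochhammer (R : realType) (a : R) (k : nat) : R :=
  \prod_(i < k) (a + i%:R).

Definition orthogonal_polynomials (R : realType)
    (ip : {poly R} -> {poly R} -> R) (p : nat -> {poly R}) : Prop :=
  (forall k, size (p k) = k.+1) /\
  (forall j k, j <> k -> ip (p j) (p k) = 0).

(* A Lebesgue integral, finite for alpha, beta > -1; [Rintegral] is 0 by
   convention for non-integrable functions. *)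
Definition jacobi_ip (R : realType) (alpha beta : R) (f g : {poly R}) : R :=
  \int[@lebesgue_measure R]_(t in `[(-1)%R, 1%R])
    (f.[t] * g.[t] * (1 - t) `^ alpha * (1 + t) `^ beta).

(* P is the sequence of Jacobi polynomials P_k^(alpha,beta), for
   alpha, beta > -1; these conditions determine P uniquely. *)
Definition jacobi_polynomials (R : realType) (alpha beta : R)
    (P : nat -> {poly R}) : Prop :=
  orthogonal_polynomials (jacobi_ip alpha beta) P /\
  (forall k, (P k).[1] = pochhammer (alpha + 1) k / (k`!)%:R).

Definition sobolev_ip (R : realType) (lambda : R) (kappa : nat) (beta : R)
    (f g : {poly R}) : R :=
  lambda / 2 ^+ (kappa + 3) *
    (\int[@lebesgue_measure R]_(t in `[(-1)%R, 1%R])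
      (f.[t] * g.[t] * (1 - t) ^+ (kappa + 2) * (1 + t) `^ beta)) +
  \int[@lebesgue_measure R]_(t in `[(-1)%R, 1%R])
    ((((1 - 'X) * f)^`()).[t] * (((1 - 'X) * g)^`()).[t] *
     (1 + t) `^ (beta + 1)).

(* Main.v *)
Require Import Defs.
From mathcomp Require Import all_boot all_order all_algebra.
From mathcomp Require Import all_classical all_reals all_analysis.
From mathcomp Require Import measurable_realfun zify ring lra.

(* Integrating by parts, the derivative part of (P_k, g)_beta becomes
   - int P_k h (1-t)(1+t)^beta dt with h a polynomial of degree at most deg g,
   the boundary terms vanishing because of the factors 1-t and (1+t)^(beta+1).
   The other part is the Jacobi inner product of P_k with a multiple of
   g (1-t)^(kappa+1).  Hence (P_k, g)_beta = 0 whenever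
   deg g + kappa + 1 < k, which truncates the Fourier expansion of P_k - q_k
   in the q_j.  The integration by parts is purely algebraic once it is known
   on the powers of 1+t. *)

Set Implicit Arguments.
Unset Strict Implicit.
Unset Printing Implicit Defensive.

Import Order.TTheory GRing.Theory Num.Theory.
Import numFieldNormedType.Exports.
Local Open Scope classical_set_scope.
Local Open Scope ring_scope.

(** * Integrals of powers of 1+t over [-1,1], and integrability of the weight *)

Lemma is_derive_powR1D (R : realType) (g t : R) : -1 < t ->
  is_derive t 1 (fun x => (1 + x) `^ g) (g * (1 + t) `^ (g - 1)).
Proof.
move=> t1; have t0 : 0 < 1 + t by lra.
have h1 : is_derive t 1 (fun x : R => 1 + x) 1.
  have := is_deriveD (is_derive_cst (1:R) t 1) (is_derive_id t 1).
  by rewrite add0r.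
have := is_derive1_comp (is_derive1_powR g t0) h1.
by rewrite mulr1.
Qed.

(** Fundamental theorem of calculus with antiderivative (1+t)^g; the integrand is continuous on
    [a,1] because a > -1. *)
Lemma integral_powR1D_trunc (R : realType) (g a : R) : -1 < a -> a < 1 ->
  (\int[@lebesgue_measure R]_(t in `[a, 1%R]) (g * (1 + t) `^ (g - 1))%:E =
   (2 `^ g - (1 + a) `^ g)%:E)%E.
Proof.
move=> a0 a1.
have cts (h t : R) : a <= t -> {for t, continuous (fun x : R => (1 + x) `^ h)}.
  move=> at1; have t1 : -1 < t by lra.
  have [d _] := is_derive_powR1D h t1.
  by move/derivable1_diffP: d => /differentiable_continuous.
rewrite (@continuous_FTC2 R _ (fun t => (1 + t) `^ g) a 1 a1) //.
- apply: continuous_in_subspaceT => x /set_mem /=; rewrite in_itv /= => /andP[ax _].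
  have := @continuousM R R (fun=> g) (fun x : R => (1 + x) `^ (g - 1)) x.
  by apply; [exact: cst_continuous | exact: cts].
- split.
  + move=> x; rewrite in_itv /= => /andP[ax _].
    have x1 : -1 < x by lra.
    by case: (is_derive_powR1D g x1).
  + by apply: cvg_at_right_filter; apply: cts.
  + by apply: cvg_at_left_filter; apply: cts; exact: ltW.
- move=> x; rewrite in_itv /= => /andP[ax _].
  rewrite derive1E; apply: derive_val.
  by apply: is_derive_powR1D; lra.
Qed.

Lemma measurable_powR1D (R : realType) (b : R) (D : set R) :
  measurable_fun D (fun t => (1 + t) `^ b).
Proof.
apply: measurable_funTS.
apply: (@measurableT_comp _ _ _ _ _ _ (fun y => y `^ b)).
  exact: measurable_powR.
exact: measurable_funD.
Qed.

(* For g < 1 the integrand is unbounded near -1, hence the passage to the limit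
   from the intervals [-1 + 1/(n + 1), 1]. *)
Lemma integral_powR1D (R : realType) (g : R) : 0 < g ->
  (\int[@lebesgue_measure R]_(t in `](-1)%R, 1%R]) (g * (1 + t) `^ (g - 1))%:E =
   (2 `^ g)%:E)%E.
Proof.
move=> g0; rewrite itv_open_bnd_bigcup.
set F := (fun n : nat => [set` `[(-1) + n.+1%:R^-1, (1:R)]]) : (set (measurableTypeR R))^nat.
set f := EFin \o (fun t : R => g * (1 + t) `^ (g - 1)).
have mf (D : set R) : measurable_fun D f.
  apply/measurable_EFinP/measurable_funM => //; exact: measurable_powR1D.
have h0 := @ge0_nondecreasing_set_cvg_integral _ _ R F f (@lebesgue_measure R).
have h : (\int[@lebesgue_measure R]_(x in F i) f x)%E @[i --> \oo] -->
           (\int[@lebesgue_measure R]_(x in \bigcup_i F i) f x)%E.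
  apply: h0.
  - apply/nondecreasing_seqP => n; rewrite /F; apply/subsetPset => x /=.
    rewrite !in_itv /= => /andP[h ->]; rewrite andbT; apply: le_trans h.
    by rewrite lerD2l lef_pV2 ?posrE ?ltr0n // ler_nat.
  - by move=> i; exact: measurable_itv.
  - by move=> i; exact: mf.
  - move=> i x _; rewrite /f /= lee_fin mulr_ge0 ?powR_ge0 //; exact: ltW.
apply: (cvg_unique (@ereal_hausdorff R) h).
(* The truncated integrals, whose limit monotone convergence has just given, equal 2^g - (n+1)^(-g);
   here g > 0 makes the last term tend to 0. *)
have h2 : (2 `^ g - (n.+1%:R^-1 : R) `^ g)%:E @[n --> \oo] --> (2 `^ g)%:E.
  apply: cvg_EFin; first exact: nearW.
  rewrite -[X in _ --> X]subr0.
  apply: cvgB; first exact: cvg_cst.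
  have /cvg_at_rightP := powR_cvg0 g0; apply; split; last exact: cvg_harmonic.
  by move=> n; rewrite invr_gt0 ltr0n.
apply: cvg_trans h2; apply: near_eq_cvg; near=> n.
rewrite /F integral_powR1D_trunc.
- by rewrite addrA subrr add0r.
- by rewrite ltrDl invr_gt0 ltr0n.
- apply: le_lt_trans (@ltr01 R).
  by rewrite addrC subr_le0 invf_le1 ?ltr0n // ler1n.
Unshelve. all: by end_near.
Qed.

(** The integrand is nonnegative, so a finite integral suffices; the formula above with g = beta + 1
    > 0 provides it, up to the factor beta + 1. *)
Lemma integrable_powR1D (R : realType) (beta : R) : -1 < beta ->
  (@lebesgue_measure R).-integrable `[(-1)%R, 1%R]
    (EFin \o (fun t => (1 + t) `^ beta)).
Proof.
move=> hb; have g0 : 0 < beta + 1 by lra.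
pose h := (fun t : R => (beta + 1) * (1 + t) `^ (beta + 1 - 1)).
have ih : (@lebesgue_measure R).-integrable `[(-1)%R, 1%R] (EFin \o h).
  apply/integrableP; split.
    apply/measurable_EFinP/measurable_funM => //; exact: measurable_powR1D.
  have -> : (\int[@lebesgue_measure R]_(t in `[(-1)%R, 1%R]) `|(EFin \o h) t| =
             \int[@lebesgue_measure R]_(t in `[(-1)%R, 1%R]) (h t)%:E)%E.
    by apply: eq_integral => t _; rewrite /= ger0_norm // mulr_ge0 ?powR_ge0 ?ltW.
  rewrite -integral_itv_obnd_cbnd; last first.
    apply/measurable_EFinP/measurable_funM => //; exact: measurable_powR1D.
  by rewrite (integral_powR1D g0) ltry.
have mD : measurable (`[(-1)%R, 1%R] : set (measurableTypeR R)) by exact: measurable_itv.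
apply: (eq_integrable mD _ _ _ (integrableZl mD (beta + 1)^-1 ih)) => t _.
rewrite /= /h -EFinM mulrA mulVf ?mul1r ?addrK //.
exact: lt0r_neq0.
Qed.

(** A polynomial is bounded on the compact interval [-1,1], so multiplying by it preserves
    integrability. *)
Lemma integrable_poly_powR1D (R : realType) (beta : R) (p : {poly R}) :
  -1 < beta ->
  (@lebesgue_measure R).-integrable `[(-1)%R, 1%R]
    (EFin \o (fun t => p.[t] * (1 + t) `^ beta)).
Proof.
move=> hb.
have mD : measurable (`[(-1)%R, 1%R] : set (measurableTypeR R)) by exact: measurable_itv.
have := @integrableMr _ _ R _ _ mD (horner p) _ _ _ (integrable_powR1D hb).
apply.
- exact: measurable_poly.
- have cp : {within `[(-1)%R, 1%R], continuous (horner p : R -> R^o)}.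
    by apply: continuous_subspaceT; exact: continuous_horner.
  have /compact_bounded[M [Mr hM]] := continuous_compact cp (@segment_compact R _ _).
  by exists M; split => // x Mx y yD; apply: (hM x Mx); exists y.
Qed.

(** * Zeros of polynomials, and the linear functional given by the weight (1+t)^beta *)

Lemma root_seq_exists (R : idomainType) (p : {poly R}) : p != 0 ->
  exists s : seq R, forall x, root p x -> x \in s.
Proof.
have [n] := ubnP (size p); elim: n p => // n IH p sp p0.
have [[a ra]|nr] := pselect (exists a, root p a); last first.
  by exists [::] => x rx; case: nr; exists x.
have [q pq] := factor_theorem p a ra.
have q0 : q != 0 by apply: contraNneq p0 => q0; rewrite pq q0 mul0r.
have [|s hs] := IH q _ q0.
  by move: sp; rewrite pq size_Mmonic ?monicXsubC // size_XsubC addn2.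
exists (a :: s) => x; rewrite pq rootM root_XsubC in_cons orbC.
by case/orP => [->//|/hs ->]; rewrite orbT.
Qed.

(** Both inner products are expressed through this one functional: factors 1-t, and the extra factor
    1+t of the derivative term, are absorbed into the polynomial. *)
Definition jacobi_moment (R : realType) (beta : R) (p : {poly R}) : R :=
  \int[@lebesgue_measure R]_(t in `[(-1)%R, 1%R]) (p.[t] * (1 + t) `^ beta).

Section Moment.
Variables (R : realType) (beta : R).
Hypothesis hbeta : -1 < beta.
Local Notation L := (jacobi_moment beta).

Let mD : measurable (`[(-1)%R, 1%R] : set (measurableTypeR R)).
Proof. exact: measurable_itv. Qed.

Lemma jacobi_moment_linear (a : R) (p q : {poly R}) : L (a *: p + q) = a * L p + L q.
Proof.
have ip := integrable_poly_powR1D p hbeta.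
have iq := integrable_poly_powR1D q hbeta.
rewrite /jacobi_moment -RintegralZl // -RintegralD //; last first.
  exact: (integrableZl mD a ip).
by apply: eq_Rintegral => t _; rewrite hornerD hornerZ mulrDl mulrA.
Qed.

Lemma jacobi_moment_XD1n (n : nat) :
  L ((1 + 'X) ^+ n) * (n%:R + beta + 1) = 2 ^+ n * 2 `^ (beta + 1).
Proof.
set g := n%:R + beta + 1.
have g0 : 0 < g by rewrite /g -addrA ltr_wpDl // -ltrBlDr sub0r.
have := integral_powR1D g0.
rewrite integral_itv_obnd_cbnd; last first.
  apply/measurable_EFinP/measurable_funM => //; exact: measurable_powR1D.
move=> /(congr1 fine) /= h.
rewrite -powR_mulrn // -powRD; last by rewrite pnatr_eq0 implybT.
rewrite addrA -/g -h mulrC -RintegralZl //; last exact: integrable_poly_powR1D.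
apply: eq_Rintegral => t; rewrite inE /= in_itv /= => /andP[t1 _].
rewrite horner_exp !hornerE /=.
have t0 : 0 <= 1 + t by rewrite -lerBlDl sub0r.
rewrite -mulrA; congr (_ * _).
(* At t = -1, merging the powers of 1+t requires a nonzero total exponent. For n at least 1, n +
   beta > 0; for n = 0 there is nothing to merge. *)
rewrite /g; case: (n) => [|m] /=.
  by rewrite expr0 mul1r add0r addrK.
rewrite -powR_mulrn // -powRD ?addrK //.
by rewrite gt_eqF // -natr1 -addrA ltr_wpDl // addrC -ltrBlDr sub0r.
Qed.

Lemma jacobi_momentD (p q : {poly R}) : L (p + q) = L p + L q.
Proof. by have := jacobi_moment_linear 1 p q; rewrite scale1r mul1r. Qed.

Lemma jacobi_moment0 : L 0 = 0.
Proof. by apply: (addrI (L 0)); rewrite -jacobi_momentD !addr0. Qed.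

Lemma jacobi_momentZ (a : R) (p : {poly R}) : L (a *: p) = a * L p.
Proof. by have := jacobi_moment_linear a p 0; rewrite jacobi_moment0 !addr0. Qed.

(* The left-hand side integrates the derivative of p(t) (1 + t)^(beta + 1). *)
Lemma jacobi_moment_deriv (p : {poly R}) :
  L (p^`() * (1 + 'X) + (beta + 1) *: p) = p.[1] * 2 `^ (beta + 1).
Proof.
(* Rewriting p in powers of 1+t reduces the claim, by linearity, to the monomials whose moments are
   known. *)
have -> : p = (p \Po ('X - 1)) \Po (1 + 'X).
  by rewrite -comp_polyA comp_polyB comp_polyX -polyC1 comp_polyC addrC addKr ?comp_polyXr.
rewrite [_ \Po (1 + 'X)]comp_polyE.
elim/big_ind: _ => [|p1 p2 h1 h2|i _].
- by rewrite deriv0 scaler0 mul0r addr0 jacobi_moment0 horner0 mul0r.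
- rewrite derivD scalerDr mulrDl addrACA jacobi_momentD h1 h2.
  by rewrite hornerD mulrDl.
set c := _`_i.
rewrite derivZ deriv_exp derivD derivX -{1}polyC1 derivC add0r mul1r.
have -> : (c *: ((1 + 'X) ^+ i.-1 *+ i)) * (1 + 'X) + (beta + 1) *: (c *: (1 + 'X) ^+ i) =
  (c * (i%:R + beta + 1)) *: (1 + 'X) ^+ i :> {poly R}.
  have -> : (c *: ((1 + 'X) ^+ i.-1 *+ i)) * (1 + 'X) = (c * i%:R) *: (1 + 'X) ^+ i :> {poly R}.
    case: (i : nat) => [|j]; first by rewrite mulr0n scaler0 mul0r mulr0 scale0r.
    by rewrite -scalerAl mulrnAl -exprSr -scaler_nat scalerA.
  by rewrite scalerA -scalerDl; congr (_ *: _); ring.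
rewrite jacobi_momentZ -mulrA (mulrC _ (L _)) jacobi_moment_XD1n //.
by rewrite hornerZ horner_exp !hornerE.
Qed.

Lemma jacobi_moment_ge0 (p : {poly R}) :
  (forall t, -1 <= t <= 1 -> 0 <= p.[t]) -> 0 <= L p.
Proof.
move=> hp; apply: Rintegral_ge0 => t; rewrite /= in_itv /= => /hp pt.
by rewrite mulr_ge0 ?powR_ge0.
Qed.

(** If the integral were 0, the nonnegative integrand would vanish almost everywhere, although p has
    only finitely many zeros. *)
Lemma jacobi_moment_gt0 (p : {poly R}) : p != 0 ->
  (forall t, -1 <= t <= 1 -> 0 <= p.[t]) -> 0 < L p.
Proof.
move=> p0 hp; rewrite lt_neqAle jacobi_moment_ge0 // andbT eq_sym.
apply/negP => /eqP Lp0.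
have ip := integrable_poly_powR1D p hbeta.
pose f := EFin \o (fun t : R => p.[t] * (1 + t) `^ beta).
have If : (\int[@lebesgue_measure R]_(t in `[(-1)%R, 1%R]) `|f t|)%E = 0%E.
  rewrite (_ : 0%E = (L p)%:E); last by rewrite Lp0.
  rewrite /jacobi_moment /Rintegral fineK; last exact: integrable_fin_num.
  apply: eq_integral => t; rewrite inE /= in_itv /= => /hp pt.
  by rewrite ger0_norm // mulr_ge0 ?powR_ge0.
have mf : measurable_fun (`[(-1)%R, 1%R] : set (measurableTypeR R)) f by case/integrableP: ip.
have /(_ If) [N [mN N0 hN]] := proj1 (ae_eq_integral_abs (@lebesgue_measure R) mD mf).
have [s hs] := root_seq_exists p0.
have cs : countable [set` s] by apply: finite_set_countable; apply/finite_seqP; exists s.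
have ms : measurable ([set` s] : set (measurableTypeR R)).
  exact: countable_measurable.
(* The endpoint -1 is left out because (1+t)^beta may vanish there. On the rest the integrand
   vanishes only at roots of p, so this interval of length 2 would lie in a null set. *)
have : (@lebesgue_measure R `](-1)%R, 1%R] = 0)%E.
  apply: (@subset_measure0 _ _ _ _ _ (N `|` [set` s])).
  - exact: measurable_itv.
  - exact: measurableU.
  - move=> t /=; rewrite in_itv /= => /andP[t1 t2].
    have [rt|nrt] := boolP (root p t); [right; exact: hs|left].
    apply: hN => /= H.
    have := H; rewrite in_itv /= ltW // t2 => /(_ isT) [] /eqP.
    rewrite mulf_eq0 (negbTE (_ : p.[t] != 0)) // powR_eq0.
    by rewrite gt_eqF // -ltrBlDl sub0r.
  - have cs0 := countable_lebesgue_measure0 cs.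
    exact: etrans (@measureU0 _ _ _ (@lebesgue_measure R) N [set` s] mN ms cs0) N0.
rewrite lebesgue_measure_itv /= lte_fin.
have -> : (-1 : R) < 1 by lra.
by rewrite -EFinB => -[]; lra.
Qed.

End Moment.

(** * Expansion in a sequence of orthogonal polynomials *)

Lemma orthogonal_expansion (R : realType) (ip : {poly R} -> {poly R} -> R)
    (q : nat -> {poly R}) (n : nat) (p : {poly R}) :
  orthogonal_polynomials ip q -> (size p <= n)%N ->
  exists c : nat -> R, p = \sum_(0 <= j < n) c j *: q j.
Proof.
move=> [sq _]; elim: n p => [|n IH] p sp.
  by exists (fun=> 0); rewrite big_geq //; apply/eqP; rewrite -size_poly_leq0.
have ln0 : lead_coef (q n) != 0.
  by rewrite lead_coef_eq0 -size_poly_gt0 sq.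
(* This multiple of [q n] cancels the coefficient of degree n, so the remainder falls under the
   induction hypothesis. *)
pose a := p`_n / lead_coef (q n).
have [|c hc] := IH (p - a *: q n).
  apply/leq_sizeP => j; rewrite leq_eqVlt => /predU1P[<-|nj].
    by rewrite coefB coefZ /a lead_coefE sq /= divfK ?subrr // -[X in _`_X]/(n.+1.-1) -(sq n) -lead_coefE.
  rewrite coefB coefZ !nth_default ?mulr0 ?subr0 ?sq //.
  exact: leq_trans sp nj.
exists (fun j => if j == n then a else c j).
rewrite big_nat_recr //= eqxx -[LHS](subrK (a *: q n)) {1}hc.
by congr (_ + _); apply: eq_big_nat => j /andP[_ jn]; rewrite ltn_eqF.
Qed.

Lemma linear_sumr (R : realType) (ip : {poly R} -> {poly R} -> R)
    (ipP : forall f a g h, ip f (a *: g + h) = a * ip f g + ip f h)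
    (f : {poly R}) (m n : nat) (c : nat -> R) (q : nat -> {poly R}) :
  ip f (\sum_(m <= j < n) c j *: q j) = \sum_(m <= j < n) c j * ip f (q j).
Proof.
have ip0 : ip f 0 = 0.
  have := ipP f 1 0 0; rewrite scale1r addr0 mul1r => h.
  by apply: (addrI (ip f 0)); rewrite addr0.
elim/big_rec2: _ => [|j x y _ IH]; first exact: ip0.
by rewrite ipP IH.
Qed.

Lemma orthogonal_low_degree (R : realType) (ip : {poly R} -> {poly R} -> R)
    (p : nat -> {poly R}) (k : nat) (f : {poly R}) :
  (forall f a g h, ip f (a *: g + h) = a * ip f g + ip f h) ->
  orthogonal_polynomials ip p -> (size f <= k)%N -> ip (p k) f = 0.
Proof.
move=> ipP hp /(orthogonal_expansion hp) [c ->].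
rewrite (linear_sumr ipP) big_nat big1 // => j /andP[_ jk].
by rewrite hp.2 ?mulr0 // => kj; rewrite kj ltnn in jk.
Qed.

(** * The Sobolev inner product and its relation to the Jacobi one *)

Section Sobolev.
Variables (R : realType) (lambda : R) (kappa : nat) (beta : R).
Hypothesis hbeta : -1 < beta.
Local Notation L := (jacobi_moment beta).
Local Notation S := (sobolev_ip lambda kappa beta).
Local Notation J := (jacobi_ip 1 beta).

Lemma jacobi_ipE (f g : {poly R}) : J f g = L (f * g * (1 - 'X)).
Proof.
apply: eq_Rintegral => t; rewrite inE /= in_itv /= => /andP[_ t1].
by rewrite powRr1 ?subr_ge0 // !hornerE.
Qed.

Lemma sobolev_ipE (f g : {poly R}) :
  S f g = lambda / 2 ^+ (kappa + 3) * L (f * g * (1 - 'X) ^+ (kappa + 2)) +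
    L (((1 - 'X) * f)^`() * ((1 - 'X) * g)^`() * (1 + 'X)).
Proof.
rewrite /sobolev_ip; congr (_ * _ + _); apply: eq_Rintegral => t.
  by rewrite !hornerM horner_exp !hornerE.
rewrite inE /= in_itv /= => /andP[t1 _].
have t0 : 0 <= 1 + t by rewrite -lerBlDl sub0r.
rewrite !hornerM !hornerD hornerX -polyC1 hornerC -!mulrA.
congr (_ * (_ * _)).
(* (1+t)^(beta+1) = (1+t)^beta (1+t) holds at t = -1 too, since beta + 1 is nonzero. *)
rewrite powRD ?powRr1 1?mulrC //.
by rewrite gt_eqF // -ltrBlDr sub0r.
Qed.

Lemma jacobi_ip_linearr (f : {poly R}) (a : R) (g h : {poly R}) :
  J f (a *: g + h) = a * J f g + J f h.
Proof.
by rewrite !jacobi_ipE (mulrDr f) mulrDl -scalerAr -scalerAl jacobi_moment_linear.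
Qed.

Lemma sobolev_ip_linearr (f : {poly R}) (a : R) (g h : {poly R}) :
  S f (a *: g + h) = a * S f g + S f h.
Proof.
rewrite !sobolev_ipE (mulrDr f) mulrDl -scalerAr -[(a *: _) * _]scalerAl jacobi_moment_linear //.
rewrite (mulrDr (1 - _)) derivD -scalerAr derivZ (mulrDr (_^`())) mulrDl -scalerAr -[(a *: _) * _]scalerAl.
rewrite jacobi_moment_linear //; ring.
Qed.

Lemma sobolev_ipC (f g : {poly R}) : S f g = S g f.
Proof. by rewrite !sobolev_ipE (mulrC f) (mulrC (_^`())). Qed.

(** The lambda term is strictly positive and the derivative term is nonnegative. Positivity makes
    the denominators of the Fourier coefficients nonzero. *)
Lemma sobolev_ip_gt0 (f : {poly R}) : 0 < lambda -> f != 0 -> 0 < S f f.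
Proof.
move=> l0 f0; rewrite sobolev_ipE; apply: ltr_wpDr.
  apply: jacobi_moment_ge0 => // t /andP[t1 _].
  by rewrite hornerM hornerM mulr_ge0 -?expr2 ?sqr_ge0 // !hornerE -lerBlDl sub0r.
apply: mulr_gt0; first by rewrite divr_gt0 // exprn_gt0.
apply: jacobi_moment_gt0 => // [|t /andP[_ t1]].
  rewrite mulf_neq0 ?mulf_neq0 // expf_neq0 //.
  by rewrite -opprB oppr_eq0 -polyC1 polyXsubC_eq0.
by rewrite !hornerM mulr_ge0 -?expr2 ?sqr_ge0 // horner_exp exprn_ge0 // !hornerE subr_ge0.
Qed.

Lemma sobolev_ip_by_parts (f g : {poly R}) :
  S f g = lambda / 2 ^+ (kappa + 3) * J f (g * (1 - 'X) ^+ kappa.+1) -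
    J f (((1 - 'X) * g)^`()^`() * (1 + 'X) + (beta + 1) *: ((1 - 'X) * g)^`()).
Proof.
rewrite sobolev_ipE !jacobi_ipE; congr (_ * L _ + _).
  by rewrite addn2 !exprSr !mulrA.
set H := ((1 - 'X) * g)^`().
(* Integration by parts applied to (1-t) f H: the factor 1-t kills the boundary term at 1, and the
   product rule splits the integrand into the derivative term and a Jacobi inner product with f. *)
have := jacobi_moment_deriv hbeta ((1 - 'X) * f * H).
have -> : ((1 - 'X) * f * H).[1] = 0.
  by rewrite !hornerM hornerD hornerN hornerX -polyC1 hornerC subrr !mul0r.
rewrite mul0r derivM.
have -> : (((1 - 'X) * f)^`() * H + (1 - 'X) * f * H^`()) * (1 + 'X) +
    (beta + 1) *: ((1 - 'X) * f * H) =
  ((1 - 'X) * f)^`() * H * (1 + 'X) +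
    f * (H^`() * (1 + 'X) + (beta + 1) *: H) * (1 - 'X).
  rewrite -!mul_polyC; ring.
by rewrite jacobi_momentD // => /eqP; rewrite addr_eq0 => /eqP.
Qed.

(** After integration by parts, [P k] is paired with polynomials of size at most
    [size g + kappa + 1] and [size g]; neither exceeds k, so Jacobi orthogonality applies. *)
Lemma sobolev_ip_jacobi_low_degree (P : nat -> {poly R}) (k : nat) (g : {poly R}) :
  orthogonal_polynomials J P -> (size g + kappa < k)%N -> S (P k) g = 0.
Proof.
move=> hP gk; rewrite sobolev_ip_by_parts.
have low (h : {poly R}) : (size h <= k)%N -> J (P k) h = 0.
  exact: (orthogonal_low_degree jacobi_ip_linearr hP).
have sM (r p : {poly R}) m n : (size r <= m.+1 -> size p <= n -> size (r * p)%R <= m + n)%N.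
  by move=> rm pn; apply: leq_trans (size_polyMleq _ _) _; lia.
have sD (p : {poly R}) n : (size p <= n.+1 -> size p^`()%R <= n)%N.
  move=> pn; have [->|p0] := eqVneq p 0; first by rewrite deriv0 size_poly0.
  by have := leq_trans (lt_size_deriv p0) pn; rewrite ltnS.
have s1 : (size (1 - 'X : {poly R})%R <= 2)%N.
  by rewrite -opprB size_polyN -polyC1 size_XsubC.
have s2 : (size (1 + 'X : {poly R})%R <= 2)%N.
  by rewrite addrC -polyC1 size_XaddC.
have s3 : (size ((1 - 'X : {poly R}) ^+ kappa.+1)%R <= kappa.+2)%N.
  apply: leq_trans (size_poly_exp_leq _ _) _.
  by rewrite ltnS -[leqRHS]mul1n leq_mul2r -ltnS; case: (size _) s1.
have sH : (size ((1 - 'X) * g)^`()%R <= size g)%N by exact/sD/(sM _ _ 1).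
rewrite !low ?mulr0 ?subrr //.
  apply: leq_trans (size_polyD _ _) _; rewrite geq_max; apply/andP; split.
    rewrite mulrC; apply: leq_trans (sM _ _ 1 (size g) s2 _) _; last by lia.
    exact/sD/leqW.
  by apply: leq_trans (size_scale_leq _ _) _; apply: leq_trans sH _; lia.
rewrite mulrC; apply: leq_trans (sM _ _ kappa.+1 (size g) s3 _) _ => //; lia.
Qed.

End Sobolev.

(* In the range of j, truncated subtraction gives
   max(0, k - (kappa + 1)). *)
Theorem proposition4p1 (R : realType) (lambda : R) (kappa : nat) (beta : R)
    (hlambda : 0 < lambda) (hbeta : -1 < beta)
    (P : nat -> {poly R}) (hP : jacobi_polynomials 1 beta P)
    (q : nat -> {poly R})
    (hq : orthogonal_polynomials (sobolev_ip lambda kappa beta) q)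
    (hqlead : forall k : nat, lead_coef (q k) = lead_coef (P k))
    (k : nat) :
  P k = q k +
    \sum_(k - (kappa + 1) <= j < k)
      (sobolev_ip lambda kappa beta (P k) (q j) /
       sobolev_ip lambda kappa beta (q j) (q j)) *: q j.
Proof.
have [sP _] := hP.1; have [sq oq] := hq.
set S := sobolev_ip lambda kappa beta.
have SP f a g h : S f (a *: g + h) = a * S f g + S f h by exact: sobolev_ip_linearr.
(* Equal leading coefficients cancel, so the difference expands in q_j with j < k only. *)
have szD : (size (P k - q k)%R <= k)%N.
  apply/leq_sizeP => j; rewrite leq_eqVlt => /predU1P[<-|kj].
    have := hqlead k; rewrite !lead_coefE sP sq /= coefB => ->.
    by rewrite subrr.
  by rewrite coefB !nth_default ?subrr ?sP ?sq.
have [c hc] := orthogonal_expansion hq szD.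
have Pk : P k = 1 *: q k + \sum_(0 <= j < k) c j *: q j.
  by rewrite scale1r -hc addrC subrK.
(* Pairing the expansion with q_i leaves only the term j = i. *)
have cE i : (i < k)%N -> c i = S (P k) (q i) / S (q i) (q i).
  move=> ik; have qi0 : q i != 0 by rewrite -size_poly_gt0 sq.
  have Si := sobolev_ip_gt0 kappa hbeta hlambda qi0.
  have : S (q i) (P k) = S (q i) (q k) + \sum_(0 <= j < k) c j * S (q i) (q j).
    by rewrite Pk SP mul1r (linear_sumr SP).
  rewrite [S (q i) (q k)]oq ?add0r => [|ik']; last by rewrite ik' ltnn in ik.
  rewrite (bigD1_seq i) ?mem_index_iota ?iota_uniq //= big1 ?addr0 => [|j ji].
    by rewrite /S (sobolev_ipC _ _ hbeta) => ->; rewrite mulfK // gt_eqF.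
  by rewrite [S _ _]oq ?mulr0 // => ij; rewrite ij eqxx in ji.
rewrite [LHS]Pk scale1r; congr (_ + _).
(* The terms with j < k - (kappa + 1) vanish: [q j] has size j + 1, and j + 1 + kappa < k. This
   range is empty when k is at most kappa + 1. *)
rewrite (big_cat_nat (n := k - (kappa + 1))) ?leq_subr //=.
rewrite big_nat big1 ?add0r => [|j /andP[_ jk]].
  by apply: eq_big_nat => j /andP[_ jk]; rewrite cE.
rewrite cE; last by lia.
rewrite /S (sobolev_ip_jacobi_low_degree _ hbeta hP.1) ?mul0r ?scale0r // sq.
lia.
Qed.
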